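(* Let $\xi_{sp}(n)$ denote the minimum number of triples in a spreading linear triple system on $n$ vertices. Then $$0.1103\,n^2<\xi_{sp}(n),$$ while $$\xi_{sp}(n)<\left(\tfrac{5}{36}+o(1)\right)n^2$$ holds for infinitely many $n$.
   Context: A linear triple system $\mathcal{F}$ on a vertex set $V$ is a family of 3-element subsets (triples) of $V$ any two of which share at most one element. For $V'\subseteq V$, the neighbourhood $N(V')$ is the set of all $z\in V\setminus V'$ for which there exist distinct $x,y\in V'$ with $\{x,y,z\}\in\mathcal{F}$. The closure $\mathrm{cl}(V')$ is the smallest set $W\supseteq V'$ with $N(W)=\emptyset$ (it exists uniquely). A subset $V'\subseteq V$ is nontrivial if $|V'|\geq 3$ and $V'$ is not a triple of $\mathcal{F}$. The system $\mathcal{F}$ is spreading if $\mathrm{cl}(V')=V$ for every nontrivial subset $V'\subseteq V$.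
   Formalization: The lower bound 0.1103 n^2 < ξ_sp(n) is stated for all sufficiently large n, since it fails for some small n (for n = 3 the empty system is spreading, so ξ_sp(3) = 0). *)

(* Defs.v *)
From HB Require Import structures.
From mathcomp Require Import all_boot all_order all_algebra.
From mathcomp Require Import all_classical all_reals all_analysis.

Set Implicit Arguments.
Unset Strict Implicit.
Unset Printing Implicit Defensive.

Import Order.TTheory GRing.Theory Num.Theory.

Section TripleSystems.
Variable V : finType.
Implicit Types (F : {set {set V}}) (A B S W : {set V}).

Definition linear_triple_system F : bool :=
  [forall A in F, #|A| == 3] &&
  [forall A in F, forall B in F, (A != B) ==> (#|A :&: B| <= 1)].

Definition neighbourhood F S : {set V} :=
  [set z in ~: S |
    [exists x in S, exists y in S, (x != y) && ([set x; y; z] \in F)]].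

(* Sets without neighbours are stable under intersection, so the smallest one
   above S is the intersection of all of them; see the lemmas sub_cl,
   neighbourhood_cl and cl_min. *)
Definition cl F S : {set V} :=
  \bigcap_(W : {set V} | (S \subset W) && (neighbourhood F W == finset.set0)) W.

Definition nontrivial F S : bool := (3 <= #|S|) && (S \notin F).

Definition spreading F : bool :=
  [forall S : {set V}, nontrivial F S ==> (cl F S == [set: V])].

Lemma sub_cl F S : S \subset cl F S.
Proof. by apply/bigcapsP => W /andP[]. Qed.

Lemma cl_min F S W :
  S \subset W -> neighbourhood F W = finset.set0 -> cl F S \subset W.
Proof. by move=> SW NW; apply: finset.bigcap_inf; rewrite SW NW eqxx. Qed.

Lemma neighbourhood_cl F S :
  neighbourhood F (cl F S) = finset.set0.
Proof.
apply/finset.setP => z; rewrite finset.in_set0; apply/negbTE.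
apply/negP; rewrite finset.inE finset.in_setC => /andP[/negP zNcl].
move=> /exists_inP[x xcl /exists_inP[y ycl /andP[xy xyzF]]]; apply: zNcl.
apply/finset.bigcapP => W WP; have /andP[SW /eqP NW] := WP.
have clW := cl_min SW NW.
apply/negPn/negP => zW; have : z \in neighbourhood F W.
  rewrite finset.inE finset.in_setC zW /=; apply/exists_inP; exists x.
    exact: (fintype.subsetP clW).
  by apply/exists_inP; exists y; [exact: (fintype.subsetP clW)|rewrite xy].
by rewrite NW finset.in_set0.
Qed.

End TripleSystems.

Local Open Scope ring_scope.

(* Values are extended reals, so that the minimum is +oo, rather than a junk
   number, for an n having no spreading linear triple system. *)
Definition xi_sp (R : realType) (n : nat) : \bar R :=
  \big[mine/+oo%E]_(F : {set {set 'I_n}} |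
      linear_triple_system F && spreading F) (#|F|%:R)%:E.

Lemma xi_sp_le (R : realType) (n : nat) (F : {set {set 'I_n}}) :
  linear_triple_system F -> spreading F -> (xi_sp R n <= (#|F|%:R)%:E)%E.
Proof. by move=> lF sF; apply: bigmin_le_cond; rewrite lF. Qed.

Lemma xi_sp_attained (R : realType) (n : nat) (F0 : {set {set 'I_n}}) :
  linear_triple_system F0 -> spreading F0 ->
  exists2 F : {set {set 'I_n}},
    linear_triple_system F && spreading F & xi_sp R n = (#|F|%:R)%:E.
Proof.
move=> lF0 sF0; have PF0 : linear_triple_system F0 && spreading F0 by rewrite lF0.
have [|F PF xiE] := eq_bigmin (x := +oo%E : \bar R) F0
  (fun F : {set {set 'I_n}} => linear_triple_system F && spreading F)
  (fun F : {set {set 'I_n}} => (#|F|%:R)%:E) PF0.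
  by move=> i _; rewrite leey.
by exists F.
Qed.

(* Main.v *)
(** Lower bound. Let G be the graph of the pairs lying in no triple. A proper
subset of vertices containing a nontrivial set has two points in a triple that
leaves it. Applied to 3 and 4 points, this shows that G is triangle-free and
that no triple lies in a neighbourhood N(y) of G. Hence, for an edge xy of G,
every z in N(y) - x is in a triple with x, and the third vertices of these
triples are distinct and outside N(x) and N(y), so d(x) + 2 d(y) <= n + 1.
Summing over all edges and using Cauchy-Schwarz, the average degree of G is at
most (n + 1) / 3, which leaves at least n (n - 2) / 9 triples.

Upper bound. For a prime q > 2 take the points (k, x) with k in Z/6, x in Z/q,
and a point oo, so that n = 6 q + 1, with the triples
- (k, x), (k, y), (k + 1, (x + y) / 2) for x <> y,
- (k, x), (k + 2, y), (k + 4, z) for x + y + z equal to 0 (k even) or 1 (k odd),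
- oo, (k, x), (k + 1, x) for k even.
No pair (k, x), (k + 3, y) is covered, so there are at most 5 q^2 + q triples,
which is below 5/36 n^2. If a closed set has three points in a class k, then that
class is stable under a nonzero translation, hence full, and so are all the
others. If it has two points in a class and is not a triple, then it has three
points in some class. If it has at most one point in each class, then it is
contained in a triple or else has the same x in all classes, whence 3 x = 0 and
3 x = 1. *)

Require Import Defs.
From mathcomp Require Import all_boot all_order all_algebra.
From mathcomp Require Import all_classical all_reals all_analysis.
From mathcomp Require Import zify ring lra.
Import Order.TTheory GRing.Theory Num.Theory.
Import numFieldNormedType.Exports.

Set Implicit Arguments.
Unset Strict Implicit.
Unset Printing Implicit Defensive.

(** * Linear triple systems and covered pairs *)

Section TripleSystems.
Variable V : finType.
Implicit Types (F : {set {set V}}) (A B S W : {set V}).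

Lemma triple_card F A :
  linear_triple_system F -> A \in F -> #|A| = 3.
Proof. by move=> /andP[/forall_inP h _] /h/eqP. Qed.

Lemma triple_uniq F A B (x y : V) : linear_triple_system F ->
  A \in F -> B \in F -> x != y -> x \in A -> y \in A -> x \in B -> y \in B ->
  A = B.
Proof.
move=> /andP[_ /forall_inP h] AF BF xy xA yA xB yB.
have /forall_inP/(_ B BF)/implyP hAB := h A AF.
apply/eqP/negPn/negP => /hAB; apply/negP; rewrite -ltnNge.
have <- : #|[set x; y]| = 2 by rewrite cards2 xy.
by apply/subset_leq_card/fintype.subsetP => t;
  rewrite finset.in_set2 finset.inE => /orP[]/eqP->; apply/andP.
Qed.

Lemma tripleP F A (x y : V) : linear_triple_system F ->
  A \in F -> x != y -> x \in A -> y \in A ->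
  exists z, [/\ A = [set x; y; z], z != x & z != y].
Proof.
move=> lF AF xy xA yA; have cA := triple_card lF AF.
have sA : [set x; y] \subset A.
  by apply/fintype.subsetP => t; rewrite finset.in_set2 => /orP[]/eqP->.
have : #|A :\: [set x; y]| == 1 by rewrite cardsDS// cA cards2 xy.
move=> /cards1P[z Ez]; exists z.
have : z \in A :\: [set x; y] by rewrite Ez finset.inE.
rewrite finset.in_setD finset.in_set2 negb_or => /andP[/andP[zx zy] zA].
split => //; apply/eqP; rewrite eq_sym eqEcard cA.
apply/andP; split.
  by apply/fintype.subsetP => t; rewrite !finset.inE => /orP[/orP[]|]/eqP->.
by rewrite finset.setUC cardsU1 finset.in_set2 negb_or zx zy cards2 xy.
Qed.

Definition covered F (x y : V) : bool :=
  [exists A in F, (x \in A) && (y \in A)].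

Definition uncovered F (x y : V) : bool := (x != y) && ~~ covered F x y.

Lemma coveredC F x y : covered F x y = covered F y x.
Proof. by apply: eq_existsb => A; rewrite [(x \in A) && _]andbC. Qed.

Lemma uncoveredC F x y : uncovered F x y = uncovered F y x.
Proof. by rewrite /uncovered eq_sym coveredC. Qed.

Lemma covered_mem F A x y : A \in F -> x \in A -> y \in A -> covered F x y.
Proof. by move=> AF xA yA; apply/exists_inP; exists A => //; rewrite xA. Qed.

(** A superset of [S] without neighbours contains the closure of [S], which is everything, so a
    proper [W] has a neighbour. *)
Lemma spreading_step F S W : spreading F -> nontrivial F S ->
  S \subset W -> #|W| < #|V| ->
  exists x y z, [/\ x \in W, y \in W, z \notin W, x != y & [set x; y; z] \in F].
Proof.
move=> /forallP/(_ S)/implyP sF nS SW WV; have /eqP clS := sF nS.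
have : neighbourhood F W != finset.set0.
  apply/eqP => /(cl_min SW); rewrite clS => /subset_leq_card.
  by rewrite cardsT leqNgt WV.
case/set0Pn => z; rewrite finset.inE finset.in_setC => /andP[zW].
case/exists_inP => x xW /exists_inP[y yW /andP[xy xyz]].
by exists x, y, z.
Qed.

(** By linearity a covered pair lies in exactly one triple, and a triple carries six ordered
    pairs. *)
Lemma card_covered F : linear_triple_system F ->
  #|[set u : V * V | (u.1 != u.2) && covered F u.1 u.2]| = 6 * #|F|.
Proof.
move=> lF; rewrite mulnC -sum_nat_const -sum1_card.
rewrite (eq_bigl (fun u : V * V => (u.1 != u.2) && covered F u.1 u.2));
  last by move=> u; rewrite finset.inE.
rewrite big_mkcond.
transitivity (\sum_(u : V * V)
  \sum_(A in F | (u.1 != u.2) && ((u.1 \in A) && (u.2 \in A))) 1).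
  apply: eq_bigr => -[x y] _ /=; case: ifP.
    move=> /andP[xy /exists_inP[A AF /andP[xA yA]]].
    rewrite (big_pred1 A)// => B /=; rewrite xy /=.
    apply/idP/eqP => [/andP[BF /andP[xB yB]]|->]; last by rewrite AF xA yA.
    exact: (triple_uniq lF BF AF xy).
  move=> n; rewrite big_pred0// => A; apply: contraFF n.
  move=> /andP[AF /andP[xy /andP[xA yA]]].
  by rewrite xy (covered_mem AF).
rewrite (exchange_big_dep (mem F)) /=; last by move=> u A _ /andP[].
apply: eq_bigr => A AF; have cA := triple_card lF AF.
rewrite -(pair_big_dep xpredT (fun x y => (A \in F) &&
  ((x != y) && ((x \in A) && (y \in A)))) (fun _ _ => 1)) /=.
rewrite (bigID (mem A)) /= [X in _ + X]big1 ?addn0; last first.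
  by move=> x xA; apply: big_pred0 => y; rewrite (negbTE xA) !andbF.
rewrite (eq_bigr (fun _ => 2)); first by rewrite sum_nat_const cA.
move=> x xA; rewrite sum1_card.
have := cardsD1 x A; rewrite xA cA => -[->]; apply: eq_card => y.
by rewrite finset.in_setD1 [LHS]unfold_in /= AF /= eq_sym.
Qed.

(** * The lower bound *)

Section LowerBound.
Variable F : {set {set V}}.
Hypotheses (lF : linear_triple_system F) (sF : spreading F) (V5 : 4 < #|V|).

Let N x := [set y | uncovered F x y].
Let d x := #|N x|.

(** Three pairwise uncovered vertices would form a nontrivial proper set without neighbours. *)
Lemma uncovered_triangle_free x y z :
  uncovered F x y -> uncovered F y z -> uncovered F x z -> False.
Proof.
move=> /andP[xy cxy] /andP[yz cyz] /andP[xz cxz].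
have cS : #|[set x; y; z]| = 3.
  rewrite finset.setUC cardsU1 finset.in_set2 negb_or ![z == _]eq_sym xz yz.
  by rewrite cards2 xy.
have cov a b : a \in [set x; y; z] -> b \in [set x; y; z] -> a != b -> ~~ covered F a b.
  by rewrite !finset.inE => /orP[/orP[]|]/eqP-> /orP[/orP[]|]/eqP->;
     rewrite ?eqxx // 1?coveredC // => _; rewrite coveredC.
have nS : nontrivial F [set x; y; z].
  rewrite /nontrivial cS /=; apply: contra cxy => SF.
  by apply: (covered_mem SF); rewrite !finset.inE eqxx ?orbT.
have [|a [b [w [aS bS wS ab abw]]]] := spreading_step sF nS (subxx _).
  by rewrite cS; apply: ltn_trans V5.
have /negP[] := cov a b aS bS ab.
by apply: (covered_mem abw); rewrite !finset.inE eqxx ?orbT.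
Qed.

(** The only triple with two points among [x], [z], [w], [y] would be [[set x; z; w]], so these four
    points would form a proper closed set around the nontrivial [[set y; x; z]]. *)
Lemma uncovered_no_triple x z w y : [set x; z; w] \in F ->
  uncovered F y x -> uncovered F y z -> uncovered F y w -> False.
Proof.
move=> xzw /andP[yx cyx] /andP[yz cyz] /andP[yw cyw].
set A := [set x; z; w] in xzw.
have cA : #|A| = 3 := triple_card lF xzw.
have cy a : a \in A -> ~~ covered F y a.
  by rewrite !finset.inE => /orP[/orP[]|]/eqP->.
have yA : y \notin A by rewrite !finset.inE !negb_or yx yz yw.
have xz : x != z.
  by apply/eqP => xz; move: cA; rewrite /A xz finset.setUid cards2; case: (_ != _).
have cW : #|y |: A| = 4 by rewrite cardsU1 yA cA.
have nS : nontrivial F [set y; x; z].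
  rewrite /nontrivial -finset.setUA cardsU1 finset.in_set2 negb_or yx yz cards2 xz /=.
  apply: contra cyx => SF.
  by apply: (covered_mem SF); rewrite !finset.inE eqxx ?orbT.
have sW : [set y; x; z] \subset y |: A.
  by apply/fintype.subsetP => t; rewrite !finset.inE => /orP[/orP[]|]->; rewrite ?orbT.
have [|a [b [t [aW bW tW ab abt]]]] := spreading_step sF nS sW.
  by rewrite cW.
have aB : a \in [set a; b; t] by rewrite !finset.inE eqxx.
have bB : b \in [set a; b; t] by rewrite !finset.inE eqxx orbT.
have tB : t \in [set a; b; t] by rewrite !finset.inE eqxx orbT.
move: aW bW; rewrite !finset.in_setU1 => /orP[/eqP ay|aA] /orP[/eqP yb|bA].
- by rewrite ay yb eqxx in ab.
- by have /negP[] := cy b bA; apply: (covered_mem abt) => //; rewrite -ay.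
- by have /negP[] := cy a aA; apply: (covered_mem abt) => //; rewrite -yb.
have AB := triple_uniq lF xzw abt ab aA bA aB bB.
by move: tW; rewrite AB finset.in_setU1 tB orbT.
Qed.

Lemma uncovered_degrees x y : uncovered F x y -> d x + (d y).*2 <= #|V|.+1.
Proof.
move=> xy.
have yx : uncovered F y x by rewrite uncoveredC.
have trip z : z \in N y :\ x -> exists w, [set x; z; w] \in F /\ ((w != x) && (w != z)).
  rewrite !finset.inE => /andP[zx yz].
  have : covered F x z.
    apply: contraT => nc; exfalso; apply: (@uncovered_triangle_free x y z) => //.
    by rewrite /uncovered eq_sym zx.
  case/exists_inP => A AF /andP[xA zA].
  have xz : x != z by rewrite eq_sym.
  have [w [EA wx wz]] := tripleP lF AF xz xA zA.
  by exists w; rewrite -EA wx wz.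
(* The third vertex of the triple through [x] and [z]; the default [x] is never taken for [z] in
   [N y :\ x]. *)
pose th z := odflt x [pick w | ([set x; z; w] \in F) && ((w != x) && (w != z))].
have thP z : z \in N y :\ x -> [/\ [set x; z; th z] \in F, th z != x & th z != z].
  move=> /trip[w [h1 h2]]; rewrite /th; case: pickP => [v /and3P[]//|/(_ w)].
  by rewrite h1 h2.
have thi : {in N y :\ x &, injective th}.
  move=> z1 z2 /[dup] /thP[h1 n1 m1] i1 /[dup] /thP[h2 n2 m2] i2 e.
  have := @triple_uniq _ _ _ x (th z1) lF h1 h2.
  rewrite eq_sym n1 e !finset.inE !eqxx !orbT => /(_ erefl erefl erefl erefl erefl) E.
  have : z1 \in [set x; z2; th z2] by rewrite -E !finset.inE eqxx orbT.
  rewrite !finset.inE => /orP[/orP[/eqP z1x|/eqP//]|/eqP z1t].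
    by move: i1; rewrite z1x !finset.inE eqxx.
  by rewrite e -z1t eqxx in m1.
pose U := [set th z | z in N y :\ x].
have cU : #|U| = (d y).-1.
  by rewrite card_in_imset// /d (cardsD1 x (N y)) finset.inE yx.
have cD : #|N y| = (d y) by [].
have dy0 : 0 < d y by apply/card_gt0P; exists x; rewrite finset.inE.
have D1 : [disjoint N x & N y].
  apply/pred0P => z /=; apply/negP => /andP[]; rewrite !finset.inE => xz yz.
  exact: (@uncovered_triangle_free x y z).
have D2 : [disjoint N x & U].
  apply/pred0P => t /=; apply/negP => /andP[+ /imsetP[z /thP[h _ _] E]].
  rewrite finset.inE => /andP[_ /negP[]].
  by apply: (covered_mem h); rewrite !finset.inE ?E eqxx ?orbT.
have D3 : [disjoint N y & U].
  apply/pred0P => t /=; apply/negP => /andP[+ /imsetP[z /[dup] /thP[h _ _] + E]].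
  rewrite !finset.inE E => yt /andP[_ yz].
  exact: (uncovered_no_triple h yx yz yt).
have c : #|N x :|: N y :|: U| = d x + d y + (d y).-1.
  rewrite cardsU finset.setIUl.
  rewrite (disjoint_setI0 D2) (disjoint_setI0 D3) finset.setU0 cards0 subn0 cU.
  by rewrite cardsU (disjoint_setI0 D1) cards0 subn0.
have := max_card (mem (N x :|: N y :|: U)); rewrite c.
by move: dy0; rewrite -addnn; lia.
Qed.

(** An ordered pair is diagonal, covered or uncovered. *)
Lemma sum_uncovered_degrees :
  6 * #|F| + \sum_x d x + #|V| = #|V| * #|V|.
Proof.
have -> : \sum_x d x = #|[set u : V * V | uncovered F u.1 u.2]|.
  rewrite -sum1_card (eq_bigl (fun u : V * V => uncovered F u.1 u.2));
    last by move=> u; rewrite finset.inE.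
  rewrite -(pair_big_dep xpredT (fun x y => uncovered F x y) (fun _ _ => 1)) /=.
  by apply: eq_bigr => x _; rewrite sum1_card; apply: eq_card => y; rewrite finset.inE.
rewrite -(card_covered lF) -[in RHS]card_prod.
set X := [set u | _]; set Y := [set u | _].
have <- : #|[set u : V * V | u.1 == u.2]| = #|V|.
  rewrite -(card_imset (mem V) (f := fun x => (x, x))); last by move=> x y [].
  apply: eq_card => -[x y]; rewrite !finset.inE /=.
  apply/eqP/imsetP => [->|[z _ [-> ->]]//]; by exists y.
rewrite -(cardsC [set u : V * V | u.1 == u.2]) addnC; congr (_ + _).
rewrite -[in RHS](cardsID [set u : V * V | covered F u.1 u.2]).
by congr (_ + _); apply: eq_card => u; rewrite !finset.inE /uncovered // andbC.
Qed.

Lemma spreading_card_lb : #|V| * #|V| <= 9 * #|F| + 2 * #|V|.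
Proof.
(* The degree inequality is summed over ordered uncovered pairs, where [d x] and [d y] both sum to
   the sum of squares. *)
have deg : 3 * \sum_x d x * d x <= #|V|.+1 * \sum_x d x.
  have E1 : \sum_x d x * d x = \sum_x \sum_(y | uncovered F x y) d x.
    by apply: eq_bigr => x _; rewrite sum_nat_const /d; congr (_ * _);
       apply: eq_card => y; rewrite !finset.inE.
  have E2 : \sum_x d x * d x = \sum_x \sum_(y | uncovered F x y) d y.
    rewrite E1 (exchange_big_dep xpredT)//=; apply: eq_bigr => x _.
    by apply: eq_bigl => y; rewrite uncoveredC.
  have -> : 3 * \sum_x d x * d x = \sum_x \sum_(y | uncovered F x y) (d x + (d y).*2).
    rewrite mulSn {1}E1 E2 big_distrr -big_split /=; apply: eq_bigr => x _.
    by rewrite big_distrr -big_split /=; apply: eq_bigr => y _; rewrite mul2n.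
  rewrite mulnC big_distrl /=; apply: leq_sum => x _.
  have -> : d x * #|V|.+1 = \sum_(y | uncovered F x y) #|V|.+1.
    by rewrite sum_nat_const; congr (_ * _); apply: eq_card => y; rewrite finset.inE.
  by apply: leq_sum => y; apply: uncovered_degrees.
(* Cauchy-Schwarz enters pointwise, as nonnegativity of the square of 3 d(x) - (n + 1). *)
have amgm : 6 * #|V|.+1 * \sum_x d x <=
    9 * \sum_x d x * d x + #|V| * (#|V|.+1 * #|V|.+1).
  rewrite !big_distrr -sum_nat_const -big_split /=; apply: leq_sum => x _.
  move: (d x) (#|V|.+1) => a b.
  by have [+ _] := nat_Cauchy (3 * a) b; rewrite -!mulnn; lia.
have := sum_uncovered_degrees.
move: (\sum_x d x * d x) (\sum_x d x) deg amgm => q s deg amgm.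
have : 3 * s <= #|V| * #|V|.+1 by rewrite -(leq_pmul2l (ltn0Sn #|V|)); lia.
by lia.
Qed.

End LowerBound.
End TripleSystems.

(** * Triple systems given by partial binary operations *)

Section PartialSteinerQuasigroups.
Variables (V : finType) (op : V -> V -> option V).

(* A partial Steiner quasigroup: [op u v] is the third point of the triple
   through [u] and [v], and [None] when there is none. *)
Definition psq_axiom :=
  [/\ forall u, op u u = None,
      forall u v, op u v = op v u
    & forall u v w, op u v = Some w -> op u w = Some v].

Definition op_closed (W : {set V}) :=
  forall u v w, u \in W -> v \in W -> op u v = Some w -> w \in W.

Definition psq_triples : {set {set V}} :=
  [set A | [exists u, exists v, exists w,
              (op u v == Some w) && (A == [set u; v; w])]].

Hypothesis opP : psq_axiom.

Lemma mem_psq_triples u v w : op u v = Some w -> [set u; v; w] \in psq_triples.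
Proof.
move=> uvw; rewrite finset.inE; apply/existsP; exists u; apply/existsP; exists v.
by apply/existsP; exists w; rewrite uvw !eqxx.
Qed.

Lemma psq_triplesP A a b : A \in psq_triples -> a \in A -> b \in A -> a != b ->
  exists2 c, op a b = Some c & A = [set a; b; c].
Proof.
have [_ opC opS] := opP.
rewrite finset.inE => /existsP[u /existsP[v /existsP[w /andP[/eqP uvw /eqP->]]]].
have vuw : op v u = Some w by rewrite opC.
have uwv := opS _ _ _ uvw; have vwu := opS _ _ _ vuw.
have wuv : op w u = Some v by rewrite opC.
have wvu : op w v = Some u by rewrite opC.
rewrite !finset.inE => /orP[/orP[]|]/eqP-> /orP[/orP[]|]/eqP->;
  rewrite ?eqxx // => _; eexists; try eassumption;
  by apply/finset.setP => t; rewrite !finset.inE;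
     case: (t == u); case: (t == v); case: (t == w).
Qed.

Lemma psq_op_neq u v w : op u v = Some w -> [/\ u != v, u != w & v != w].
Proof.
have [opx opC opS] := opP; move=> uvw.
have uwv := opS _ _ _ uvw.
have vwu : op v w = Some u by apply: opS; rewrite opC.
by split; apply/eqP => e; [move: uvw|move: uwv|move: vwu]; rewrite e opx.
Qed.

Lemma psq_triples_linear : linear_triple_system psq_triples.
Proof.
apply/andP; split.
  apply/forall_inP => A; rewrite finset.inE.
  case/existsP => u /existsP[v /existsP[w /andP[/eqP /psq_op_neq[uv uw vw] /eqP->]]].
  rewrite finset.setUC cardsU1 finset.in_set2 negb_or ![w == _]eq_sym uw vw.
  by rewrite cards2 uv.
apply/forall_inP => A AF; apply/forall_inP => B BF; apply/implyP => AB.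
rewrite leqNgt; apply: contra AB => /card_gt1P[a [b]].
rewrite !finset.inE => -[/andP[aA aB] /andP[bA bB] ab].
have [c Ec ->] := psq_triplesP AF aA bA ab.
by have [c' + ->] := psq_triplesP BF aB bB ab; rewrite Ec => -[->].
Qed.

Lemma psq_triples_card :
  6 * #|psq_triples| <= #|[set u : V * V | op u.1 u.2 != None]|.
Proof.
rewrite -(card_covered psq_triples_linear); apply/subset_leq_card/fintype.subsetP.
move=> [u v]; rewrite !finset.inE /= => /andP[uv /exists_inP[A AF /andP[uA vA]]].
by have [c -> _] := psq_triplesP AF uA vA uv.
Qed.

(** The hypothesis is applied to the closure of a nontrivial [S]; were that closure a triple, [S]
    would equal it. *)
Lemma psq_triples_spreading :
  (forall W : {set V},
     2 < #|W| -> W \notin psq_triples -> op_closed W -> W = [set: V]) ->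
  spreading psq_triples.
Proof.
move=> h; apply/forallP => S; apply/implyP => /andP[S3 SF]; apply/eqP/h.
- exact: leq_trans S3 (subset_leq_card (sub_cl _ _)).
- apply: contra SF => clF; have c3 := triple_card psq_triples_linear clF.
  suff -> : S = cl psq_triples S by [].
  by apply/eqP; rewrite eqEcard sub_cl c3.
move=> u v w uW vW uvw; apply: contraT => wW.
have : w \in neighbourhood psq_triples (cl psq_triples S).
  rewrite finset.inE finset.in_setC wW; apply/exists_inP; exists u => //.
  apply/exists_inP; exists v => //; rewrite mem_psq_triples//.
  by have [-> _ _] := psq_op_neq uvw.
by rewrite neighbourhood_cl finset.in_set0.
Qed.

End PartialSteinerQuasigroups.

(** * The construction *)

Section Construction.
Variable F : finFieldType.
Local Open Scope ring_scope.

(** Successor in Z/3, with [None], [Some false], [Some true] for 0, 1, 2. *)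
Definition rot3 (i : option bool) : option bool :=
  match i with
  | None => Some false | Some false => Some true | Some true => None
  end.

(* [bool * option bool] encodes Z/6 = Z/2 x Z/3, and [next] is [k |-> k + 1];
   the parity of a class is its first component. *)
Definition next (k : bool * option bool) := (~~ k.1, rot3 k.2).

(* The outer [None] is the point at infinity. *)
Definition hexagon : finType := option ((bool * option bool) * F).

(** Third point through (k, x) and (k + 1, y): [y] is the midpoint of [x] and the new coordinate.
    Equal coordinates are joined to infinity for even [k] and uncovered for odd [k]. *)
Definition hex_next (k : bool * option bool) (x y : F) : option hexagon :=
  if x == y then if k.1 then None else Some None
  else Some (Some (k, y *+ 2 - x)).

(* The sum of a triple of the second kind depends on its parity [b], for
   otherwise [oo] and the six points [(k, 0)] would form a closed set. *)
Definition hex_op (u v : hexagon) : option hexagon :=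
  match u, v with
  | None, None => None
  | None, Some ((b, i), x) | Some ((b, i), x), None =>
    Some (Some ((~~ b, if b then rot3 (rot3 i) else rot3 i), x))
  | Some ((b, i), x), Some ((c, j), y) =>
    if b == c then
      if i == j then
        if x == y then None else Some (Some (next (b, i), (x + y) / 2))
      else Some (Some ((b, if j == rot3 i then rot3 j else rot3 i),
                       b%:R - x - y))
    else if j == rot3 i then hex_next (b, i) x y
    else if i == rot3 j then hex_next (c, j) y x
    else None
  end.

Hypothesis two_neq0 : 2 != 0 :> F.
Hypothesis natF : forall t : F, exists n : nat, t = n%:R.

Lemma hex_opP : psq_axiom hex_op.
Proof.
split.
- by case=> [[[b i] x]|] //=; rewrite !eqxx.
- case=> [[[b i] x]|]; case=> [[[c j] y]|] //=.
  rewrite (eq_sym c b) (eq_sym j i) (eq_sym y x) (addrC y x).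
  rewrite (addrAC _ (- y)).
  by case: b; case: c; case: i => [[]|]; case: j => [[]|].
(* Midpoint and reflection undo each other, and on distinct points they give a coordinate different
   from both, so the exchange law never falls into the branch of equal coordinates. *)
have midE (x y : F) : ((x + y) / 2) *+ 2 - x = y.
  by rewrite -mulr_natr mulfVK// addrAC subrr add0r.
have refE (x y : F) : (x + (y *+ 2 - x)) / 2 = y.
  by rewrite addrC subrK -(mulr_natr y) mulfK.
have tE (c x y : F) : c - x - (c - x - y) = y by ring.
have n1 (x y : F) : x != y -> (x == (x + y) / 2) = false.
  move=> xy; apply: contraNF xy => /eqP e.
  by have := midE x y; rewrite -e mulr2n addrK => ->.
have n2 (x y : F) : x != y -> (x == y *+ 2 - x) = false.
  move=> xy; apply: contraNF xy => /eqP e.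
  by have := refE x y; rewrite -e -mulr2n -(mulr_natr x) mulfK// => ->.
have n3 (x y : F) : x != y -> (y == y *+ 2 - x) = false.
  move=> xy; apply: contraNF xy => /eqP e.
  have -> : x = y *+ 2 - (y *+ 2 - x) by ring.
  by rewrite -e mulr2n addrK.
case=> [[[[] [[]|]] x]|]; case=> [[[[] [[]|]] y]|] w //=; rewrite /hex_next /=;
 rewrite ?(eq_sym y x) //;
 try (case: (eqVneq x y) => [<-|xy]); move=> // -[<-] /=;
 try (have yx : y != x by rewrite eq_sym);
 try done;
 by rewrite /hex_next /= ?eqxx ?midE ?refE ?tE ?n1 ?n2 ?n3 // [_ == x]eq_sym n3 //
            subKr.
Qed.


(** Every difference is a natural multiple of [d], since every element is a natural multiple of
    1. *)
Lemma natF_translation_full (A : {set F}) (d : F) : d != 0 -> A != finset.set0 ->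
  (forall t, t \in A -> t + d \in A) -> A = [set: F].
Proof.
move=> d0 /set0Pn[x xA] Ad; apply/finset.setP => t; rewrite finset.in_setT.
have [n E] := natF ((t - x) / d).
have -> : t = x + d *+ n by rewrite -mulr_natr -E mulrC mulfVK// addrC subrK.
by elim: n {E} => [|n IH]; rewrite ?mulr0n ?addr0 // mulrSr addrA Ad.
Qed.

(** * Closed sets with two points in one class *)

Section ClosedSets.
Variable W : {set hexagon}.
Hypothesis clW : op_closed hex_op W.

Let p k x := Some (k, x) \in W.

Lemma mid_mem k x y : p k x -> p k y -> x != y -> p (next k) ((x + y) / 2).
Proof.
case: k => b i px py xy; apply: (clW px py).
by rewrite /= !eqxx (negbTE xy).
Qed.

Lemma refl_mem k x y : p k x -> p (next k) y -> x != y -> p k (y *+ 2 - x).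
Proof.
case: k => b i px py xy; apply: (clW px py).
by rewrite /= /hex_next (negbTE xy); case: b {px py}; case: i => [[]|].
Qed.

Lemma triad_mem k x y : p k x -> p (next (next k)) y ->
  p (next (next (next (next k)))) (k.1%:R - x - y).
Proof.
case: k => b i px py; apply: (clW px py).
by rewrite /=; case: b {px py}; case: i => [[]|].
Qed.

Lemma triad_mem' k x y : p k x -> p (next (next (next (next k)))) y ->
  p (next (next k)) (k.1%:R - x - y).
Proof.
case: k => b i px py; apply: (clW px py).
by rewrite /=; case: b {px py}; case: i => [[]|].
Qed.

Lemma infty_mem i x : p (false, i) x -> p (true, rot3 i) x -> None \in W.
Proof.
move=> px py; apply: (clW px py).
by rewrite /= /hex_next !eqxx.
Qed.

Lemma infty_next i x : None \in W -> p (false, i) x -> p (true, rot3 i) x.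
Proof. by move=> oW px; apply: (clW oW px). Qed.

Lemma infty_prev i x : None \in W -> p (true, rot3 i) x -> p (false, i) x.
Proof. by move=> oW px; apply: (clW oW px); case: i {px} => [[]|]. Qed.

Lemma next_cycle (k l : bool * option bool) :
  l \in [:: k; next k; next (next k); next (next (next k));
            next (next (next (next k))); next (next (next (next (next k))))].
Proof. by case: k => [[] [[]|]]; case: l => [[] [[]|]]. Qed.

Lemma next6 k : next (next (next (next (next (next k))))) = k.
Proof. by case: k => [[] [[]|]]. Qed.

Lemma three_points_full k x y z : p k x -> p k y -> p k z ->
  x != y -> x != z -> y != z -> W = [set: hexagon].
Proof.
move=> px py pz xy xz yz.
(* This reflects [c] in the midpoint of [a] and [b]; if [c] is that midpoint, the value is [c]
   itself. *)
have tern a b c : p k a -> p k b -> p k c -> a != b -> p k (a + b - c).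
  move=> pa pb pc ab; have pm := mid_mem pa pb ab.
  have mE : (a + b) / 2 *+ 2 = a + b by rewrite -mulr_natr mulfVK.
  have [cE|cm] := eqVneq c ((a + b) / 2); last by rewrite -mE refl_mem.
  by rewrite -mE -cE mulr2n addrK.
have fullk : forall t, p k t.
  have : [set t | p k t] = [set: F].
    apply: (@natF_translation_full _ (y - z)); first by rewrite subr_eq0.
      by apply/set0Pn; exists x; rewrite finset.inE.
    move=> t; rewrite !finset.inE => pt; rewrite addrA.
    have [->|ty] := eqVneq t y; last exact: tern.
    (* [2 y - z] is reached as [w + y - x] with [w = x + y - z]. *)
    have -> : y + y - z = x + y - z + y - x by ring.
    apply: (tern (x + y - z)) => //; first exact: tern.
    by rewrite -subr_eq0 addrAC addrK subr_eq0.
  by move=> /finset.setP h t; have := h t; rewrite !finset.inE.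
have step l : (forall t, p l t) -> forall t, p (next l) t.
  move=> h t; have -> : t = (t + 1 + (t - 1)) / 2.
    by rewrite addrACA subrr addr0 -mulr2n -(mulr_natr t) mulfK.
  apply: mid_mem => //; apply: contraNneq two_neq0 => e.
  have -> : 2 = t + 1 - (t - 1) :> F by ring.
  by rewrite e subrr.
have full l t : p l t.
  have := next_cycle k l; rewrite !inE.
  by do 5?[case/orP]; move=> /eqP->; do ?apply: (step _) => //.
have oW := @infty_mem None 0 (full _ _) (full _ _).
by apply/finset.setP => -[[l t]|]; rewrite finset.in_setT ?oW //; apply: full.
Qed.

(** Reflecting [x] in [w] gives a third point of class [k], different from [y] because [w] is not
    the midpoint. *)
Lemma two_points_next_full k x y w : p k x -> p k y -> x != y ->
  p (next k) w -> w != (x + y) / 2 -> W = [set: hexagon].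
Proof.
wlog wx : x y / w != x => [hw|].
  have [wE|wx] := eqVneq w x; last by move=> *; apply: (hw x y).
  move=> px py xy pw wm; apply: (hw y x) => //; first by rewrite wE.
    by rewrite eq_sym.
  by rewrite addrC.
move=> px py xy pw wm; have pz := refl_mem px pw; rewrite eq_sym in pz.
have E : (w *+ 2 - x + x) / 2 = w by rewrite subrK -(mulr_natr w) mulfK.
apply: (three_points_full px py (pz wx)) => //.
  apply: contraNneq wx => e; rewrite -{1}E -e -mulr2n -(mulr_natr x) mulfK//.
by apply: contraNneq wm => ->; rewrite addrC E.
Qed.

(** Reflecting [w] in [x] gives a second point of class [k]; the two have midpoint [x], and [y] lies
    off it. *)
Lemma two_points_prev_full k x y w : p (next k) x -> p (next k) y -> x != y ->
  p k w -> W = [set: hexagon].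
Proof.
wlog wx : x y / w != x => [hw|].
  have [wE|wx] := eqVneq w x; last by move=> *; apply: (hw x y).
  by move=> px py xy pw; apply: (hw y x) => //; [rewrite wE|rewrite eq_sym].
move=> px py xy pw; have pz := refl_mem pw px wx.
have E : (w + (x *+ 2 - w)) / 2 = x by rewrite addrC subrK -(mulr_natr x) mulfK.
apply: (two_points_next_full pw pz _ py).
  by apply: contraNneq wx => e; rewrite -E -e -mulr2n -(mulr_natr w) mulfK.
by rewrite E eq_sym.
Qed.

(** Triads through [w] give two points of class k + 4, whose midpoint lies in class k + 5, just
    before [k]. *)
Lemma two_points_opp_full k x y w : p k x -> p k y -> x != y ->
  p (next (next k)) w -> W = [set: hexagon].
Proof.
move=> px py xy pw.
have neq : k.1%:R - x - w != k.1%:R - y - w.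
  by apply: contraNneq xy => /addIr/addrI/oppr_inj->.
have pm := mid_mem (triad_mem px pw) (triad_mem py pw) neq.
by apply: (two_points_prev_full (k := next (next (next (next (next k)))))) xy pm;
  rewrite next6.
Qed.

Lemma two_points_full k x y q : p k x -> p k y -> x != y -> q \in W ->
  q \notin [set Some (k, x); Some (k, y); Some (next k, (x + y) / 2)] ->
  W = [set: hexagon].
Proof.
move=> px py xy qW; rewrite !finset.inE !negb_or => /andP[/andP[qx qy] qm].
have pm := mid_mem px py xy.
have prev5 w : p (next (next (next (next (next k))))) w -> W = [set: hexagon].
  by apply: (two_points_prev_full (x := x) (y := y)) => //; rewrite next6.
case: q qW qx qy qm => [[l w]|] qW qx qy qm.
  have := next_cycle k l; rewrite !inE.
  do 5?[case/orP]; move=> /eqP lE; rewrite lE in qW qx qy qm.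
  - apply: (three_points_full px py qW) => //.
      by apply: contraNneq qx => ->.
    by apply: contraNneq qy => ->.
  - apply: (two_points_next_full px py xy qW).
    by apply: contraNneq qm => ->.
  - exact: two_points_opp_full px py xy qW.
  (* Class k + 3 forms a triad with the midpoint in class k + 1, landing in class k + 5. *)
  - exact: prev5 (triad_mem pm qW).
  - exact: two_points_opp_full px py xy (triad_mem' px qW).
  - exact: prev5 qW.
(* Infinity takes [x] to class k - 1 for odd [k]. For even [k] it takes [x] and [y] to class k + 1,
   where one of them is not the midpoint. *)
case: k px py pm prev5 qx qy qm => [[] i] px py pm prev5 qx qy qm.
  apply: (prev5 x); apply: (clW qW px); by case: i {px py pm prev5 qx qy qm} => [[]|].
have [e|] := eqVneq x ((x + y) / 2); last first.
  exact: two_points_next_full px py xy (infty_next qW px).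
apply: (two_points_next_full px py xy (infty_next qW py)).
by rewrite -e eq_sym.
Qed.

(** * Proper nontrivial closed sets do not exist *)

Section NontrivialClosedSets.
Hypotheses (W3 : (2 < #|W|)%N) (WF : W \notin psq_triples hex_op).
Hypothesis WT : W != [set: hexagon].

Lemma mem_outside_triple u v w : u \in W -> v \in W -> hex_op u v = Some w ->
  exists2 q, q \in W & q \notin [set u; v; w].
Proof.
move=> uW vW uvw; apply/fintype.subsetPn; apply: contra WF => sW.
rewrite (_ : W = [set u; v; w]); first exact: mem_psq_triples.
apply/eqP; rewrite finset.eqEsubset sW; apply/fintype.subsetP => t; rewrite !finset.inE.
by move=> /orP[/orP[]|] /eqP-> //; apply: clW uvw.
Qed.

Lemma class_uniq k x y : p k x -> p k y -> x = y.
Proof.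
move=> px py; apply/eqP/negPn/negP => xy; have /eqP := WT; apply.
have [|q qW qN] := mem_outside_triple (w := Some (next k, (x + y) / 2)) px py.
  by case: k {px py} => b i /=; rewrite !eqxx (negbTE xy).
exact: two_points_full px py xy qW qN.
Qed.

(** Otherwise reflecting [x] in [y] would give a second point of class [k]. *)
Lemma next_eq k x y : p k x -> p (next k) y -> x = y.
Proof.
move=> px py; apply/eqP/negPn/negP => xy.
have /eqP := class_uniq px (refl_mem px py xy).
rewrite -subr_eq0 opprB addrA -mulr2n -mulrnBl -mulr_natr mulf_eq0.
by rewrite (negbTE two_neq0) orbF subr_eq0 (negbTE xy).
Qed.

Lemma parity_full b i j x y l : p (b, i) x -> p (b, j) y -> i != j ->
  exists z, p (b, l) z.
Proof.
move=> px py ij.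
have pz : p (b, if j == rot3 i then rot3 j else rot3 i) (b%:R - x - y).
  by apply: (clW px py); rewrite /= eqxx (negbTE ij).
have : l \in [:: i; j; if j == rot3 i then rot3 j else rot3 i].
  by case: i ij {px py pz} => [[]|]; case: j => [[]|]; case: l => [[]|].
by rewrite !inE => /orP[|/orP[]] /eqP->; [exists x|exists y|eexists; exact: pz].
Qed.

(** Without infinity, two of three points share a parity, so all three classes of that parity are
    occupied. A point outside their triad has the other parity and shares its coordinate with an
    adjacent class. *)
Lemma infty_mem_closed : None \in W.
Proof.
apply: contraT => oW; exfalso; have /negP := oW; apply.
have diff b i j x y : p (b, i) x -> p (b, j) y ->
    Some ((b, i), x) != Some ((b, j), y) :> hexagon -> i != j.
  move=> px py; apply: contra_neq => e; rewrite -e in py *.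
  by rewrite (class_uniq px py).
have [b [i [j [x [y [px py ij]]]]]] :
    exists b i j x y, [/\ p (b, i) x, p (b, j) y & i != j].
  have /card_gt2P[u [v [w [[uW vW wW] [uv vw wu]]]]] := W3.
  case: u uW uv wu => [[[b1 i1] x1]|]; last by rewrite (negbTE oW).
  case: v vW vw => [[[b2 i2] x2]|]; last by rewrite (negbTE oW).
  case: w wW => [[[b3 i3] x3]|]; last by rewrite (negbTE oW).
  move=> p3 p2 n23 p1 n12 n31.
  have [e12|n] := eqVneq b1 b2.
    by rewrite -e12 in p2 n12; exists b1, i1, i2, x1, x2;
      split; rewrite ?(diff _ _ _ _ _ p1 p2 n12).
  have [e23|n'] := eqVneq b2 b3.
    by rewrite -e23 in p3 n23; exists b2, i2, i3, x2, x3;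
      split; rewrite ?(diff _ _ _ _ _ p2 p3 n23).
  have e31 : b3 = b1 by move: n n'; case: (b1); case: (b2); case: (b3).
  by rewrite e31 in p3 n31; exists b1, i3, i1, x3, x1;
      split; rewrite ?(diff _ _ _ _ _ p3 p1 n31).
have full l := parity_full l px py ij.
have [q qW qN] : exists2 q, q \in W & forall l z, p (b, l) z -> q != Some ((b, l), z).
  pose k := if j == rot3 i then rot3 j else rot3 i.
  have E : hex_op (Some ((b, i), x)) (Some ((b, j), y)) =
      Some (Some ((b, k), b%:R - x - y)).
    by rewrite /= eqxx (negbTE ij).
  have pz : p (b, k) (b%:R - x - y) := clW px py E.
  have [q qW qN] := mem_outside_triple px py E; exists q => // l z plz.
  apply: contraNneq qN => ->; rewrite !finset.inE.
  have : l \in [:: i; j; k].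
    by rewrite /k; case: (i) ij => [[]|]; case: (j) => [[]|]; case: (l) => [[]|].
  rewrite !inE => /orP[|/orP[]] /eqP lE; rewrite lE in plz *.
  - by rewrite (class_uniq plz px) eqxx.
  - by rewrite (class_uniq plz py) eqxx orbT.
  - by rewrite (class_uniq plz pz) eqxx !orbT.
case: q qW qN => [[[c l] z] pz qN|//].
have cb : c = ~~ b.
  move: pz qN; case: (eqVneq c b) => [->|]; last by case: (c); case: (b).
  by move=> pz /(_ _ _ pz); rewrite eqxx.
(* The adjacent class is chosen so that the even one comes first, as only such pairs are joined to
   infinity. *)
case: b px py full qN cb => px py full qN cb; rewrite {}cb /= in pz.
  have [x' px'] := full (rot3 l).
  by apply: infty_mem (pz) _; rewrite (next_eq pz px').
have [x' px'] := full (rot3 (rot3 l)).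
have rl : rot3 (rot3 (rot3 l)) = l by case: (l) => [[]|].
apply: infty_mem (px') _; rewrite rl (_ : x' = z)//.
by apply: next_eq px' _; rewrite /next rl.
Qed.

Lemma nontrivial_closed_absurd : False.
Proof.
have oW := infty_mem_closed.
have rK i : rot3 (rot3 (rot3 i)) = i by case: i => [[]|].
have [i [x px]] : exists i x, p (false, i) x.
  have [u uW] : exists2 u, u \in W & u != None.
    have /card_gt1P[u [v [uW vW uv]]] := ltnW W3.
    by have [uN|] := eqVneq u None; [exists v|exists u] => //; rewrite -uN eq_sym.
  case: u uW => [[[[] i] x]|//] px _; last by exists i, x.
  by exists (rot3 (rot3 i)), x; apply: infty_prev => //; rewrite rK.
have px' := infty_next oW px.
have [j [y [py ij]]] : exists j y, p (false, j) y /\ i != j.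
  have [q qW] := mem_outside_triple oW px erefl.
  rewrite !finset.inE !negb_or => /andP[/andP[q0 q1] q2].
  case: q qW q0 q1 q2 => [[[[] l] y]|//] py _ q1 q2.
    exists (rot3 (rot3 l)), y; split; first by apply: infty_prev => //; rewrite rK.
    apply: contraNneq q2 => e; move: px'; rewrite e rK => px'.
    by rewrite (class_uniq py px').
  exists l, y; split => //; apply: contraNneq q1 => e; rewrite -e in py *.
  by rewrite (class_uniq py px).
(* Infinity takes [z] to the next odd class, which agrees with the even class after it. *)
have E (k : option bool) z z' : p (false, k) z -> p (false, rot3 (rot3 k)) z' -> z = z'.
  by move=> pz pz'; apply: (next_eq (infty_next oW pz)).
have [x0 p0] := parity_full None px py ij.
have [x1 p1] := parity_full (Some false) px py ij.
have [x2 p2] := parity_full (Some true) px py ij.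
have e02 : x0 = x2 := E None _ _ p0 p2.
have e21 : x2 = x1 := E (Some true) _ _ p2 p1.
move: p1 p2; rewrite -e21 -e02 => p1 p2.
(* With a common coordinate x, the triads give -2x = x on even classes and 1 - 2x = x on odd
   ones. *)
have even3 := class_uniq (triad_mem p0 p2) p1.
have odd3 :=
  class_uniq (triad_mem (infty_next oW p2) (infty_next oW p1)) (infty_next oW p0).
have /eqP := etrans odd3 (esym even3); rewrite /= -!addrA => /eqP/addIr/eqP.
by rewrite oner_eq0.
Qed.

End NontrivialClosedSets.
End ClosedSets.

Lemma hex_generated (W : {set hexagon}) : (2 < #|W|)%N ->
  W \notin psq_triples hex_op -> op_closed hex_op W -> W = [set: hexagon].
Proof.
move=> W3 WF clW; apply/eqP/negPn/negP.
exact: nontrivial_closed_absurd clW W3 WF.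
Qed.

(** * Counting the triples of the construction *)

Lemma card_hexagon : #|{: hexagon}| = (6 * #|F|).+1.
Proof. by rewrite card_option !card_prod card_option card_bool. Qed.

(* [hex_op] is undefined on the diagonal and between opposite classes. *)
Lemma hex_op_domain :
  (#|[set u : hexagon * hexagon | hex_op u.1 u.2 != None]| + 6 * #|F| * #|F|
     + #|{: hexagon}| <= #|{: hexagon}| * #|{: hexagon}|)%N.
Proof.
have [opx _ _] := hex_opP.
(* [(~~ k.1, k.2)] is the opposite class k + 3. *)
pose f (s : ((bool * option bool) * F * F) + hexagon) : hexagon * hexagon :=
  match s with
  | inl (k, x, y) => (Some (k, x), Some ((~~ k.1, k.2), y))
  | inr u => (u, u)
  end.
have fi : injective f.
  move=> [[[[b i] x] y]|u] [[[[c j] z] t]|v] //=.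
  - by move=> [-> -> -> _ _ ->].
  - by move=> [<-] []; case: (b).
  - by move=> [->] []; case: (c).
  - by move=> [->].
rewrite -[leqRHS]card_prod -addnA.
have -> : (6 * #|F| * #|F| + #|{: hexagon}| = #|f @: [set: _]|)%N.
  rewrite card_imset// cardsT card_sum; congr (_ + _)%N.
  by rewrite !card_prod card_option card_bool.
rewrite -(cardsC [set u : hexagon * hexagon | hex_op u.1 u.2 != None]) leq_add2l.
apply/subset_leq_card/fintype.subsetP => _ /imsetP[s _ ->]; rewrite !finset.inE negbK.
case: s => [[[[b i] x] y]|u] /=; last by rewrite opx.
by case: b; case: i => [[]|].
Qed.

End Construction.

(** * Transport to ordinals, the vertex sets of [xi_sp] *)

Section Transport.
Variables (V : finType) (op : V -> V -> option V).

Definition ord_op (i j : 'I_#|V|) : option 'I_#|V| :=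
  omap enum_rank (op (enum_val i) (enum_val j)).

Hypothesis opP : psq_axiom op.

Lemma ord_op_some i j k :
  ord_op i j = Some k <-> op (enum_val i) (enum_val j) = Some (enum_val k).
Proof.
rewrite /ord_op; case: (op _ _) => [w|] //=; split=> [[<-]|[->]].
  by rewrite enum_rankK.
by rewrite enum_valK.
Qed.

Lemma ord_opP : psq_axiom ord_op.
Proof.
have [opx opC opS] := opP; split.
- by move=> u; rewrite /ord_op opx.
- by move=> u v; rewrite /ord_op opC.
- by move=> u v w /ord_op_some/opS/ord_op_some.
Qed.

Lemma ord_op_generated :
  (forall W : {set V},
     2 < #|W| -> W \notin psq_triples op -> op_closed op W -> W = [set: V]) ->
  forall W : {set 'I_#|V|},
    2 < #|W| -> W \notin psq_triples ord_op -> op_closed ord_op W -> W = [set: 'I_#|V|].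
Proof.
move=> h W W3 WF clW; pose W0 := [set v | enum_rank v \in W].
have memW i : (i \in W) = (enum_val i \in W0) by rewrite finset.inE enum_valK.
suff W0T : W0 = [set: V] by apply/finset.setP => i; rewrite memW W0T !finset.in_setT.
apply: h.
- rewrite (_ : #|W0| = #|W|)//.
  have -> : W0 = enum_val @: W.
    apply/finset.setP => v; rewrite -[v]enum_rankK -memW.
    by apply/idP/imsetP => [iW|[i iW /enum_val_inj ->]//]; exists (enum_rank v).
  exact/card_imset/enum_val_inj.
- apply: contra WF; rewrite finset.inE.
  case/existsP => u /existsP[v /existsP[w /andP[/eqP uvw /eqP W0E]]].
  suff -> : W = [set enum_rank u; enum_rank v; enum_rank w].
    by apply: mem_psq_triples; apply/ord_op_some; rewrite !enum_rankK.
  apply/finset.setP => i; rewrite memW W0E !finset.inE -!(can_eq enum_valK).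
  by rewrite !enum_rankK.
move=> u v w uW vW uvw; rewrite -[w]enum_rankK -memW.
rewrite !finset.inE in uW vW; apply: clW uW vW _.
by apply/ord_op_some; rewrite !enum_rankK.
Qed.

Lemma ord_op_domain :
  #|[set u : 'I_#|V| * 'I_#|V| | ord_op u.1 u.2 != None]|
    <= #|[set u : V * V | op u.1 u.2 != None]|.
Proof.
pose f (u : 'I_#|V| * 'I_#|V|) : V * V := (enum_val u.1, enum_val u.2).
rewrite -(card_imset _ (f := f)); last first.
  by move=> [i j] [k l] [/enum_val_inj-> /enum_val_inj->].
apply/subset_leq_card/fintype.subsetP => _ /imsetP[u + ->].
by rewrite !finset.inE /ord_op /f /=; case: (op _ _).
Qed.

End Transport.

Lemma spreading_exists (q : nat) : prime q -> 2 < q ->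
  exists F : {set {set 'I_(6 * q).+1}},
    [/\ linear_triple_system F, spreading F & #|F| <= 5 * q * q + q].
Proof.
move=> qp q2.
have two_neq0 : (2 != 0 :> 'F_q)%R.
  by rewrite -(dvdn_pcharf (pchar_Fp qp)) gtnNdvd.
have natF (t : 'F_q) : exists n : nat, (t = n%:R)%R by exists t; rewrite natr_Zp.
have opP := hex_opP two_neq0.
have <- : #|{: hexagon 'F_q}| = (6 * q).+1 by rewrite card_hexagon card_Fp.
exists (psq_triples (ord_op (@hex_op 'F_q))); split.
- exact/psq_triples_linear/ord_opP.
- apply/psq_triples_spreading; first exact: ord_opP.
  by apply: ord_op_generated => W; apply: hex_generated.
have := leq_trans (psq_triples_card (ord_opP opP)) (ord_op_domain _).
have := hex_op_domain two_neq0.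
move: #|psq_triples _| #|[set u | _]| => a b.
(* With n = 6 q + 1, six times the number of triples is at most n^2 - n - 6 q^2 = 30 q^2 + 6 q. *)
by rewrite card_hexagon card_Fp//; nia.
Qed.

Local Open Scope classical_set_scope.
Local Open Scope ring_scope.

Theorem theorem2 (R : realType) :
  (\forall n \near \oo, ((1103 / 10000 * n%:R ^+ 2)%:E < xi_sp R n)%E) /\
  (exists2 eps : R^nat, eps @ \oo --> (0 : R) &
    infinite_set
      [set n : nat | (xi_sp R n < ((5 / 36 + eps n) * n%:R ^+ 2)%:E)%E]).
Proof.
split.
  (* n (n - 2) / 9 exceeds 0.1103 n^2 once 0.0073 n > 2, that is, from n = 274 on. *)
  exists 300%N => // n /= n300.
  apply/Order.TotalTheory.bigmin_gtP; split; first exact: ltry.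
  move=> F /andP[lF sF]; rewrite lte_fin.
  have n5 : (4 < #|'I_n|)%N by rewrite card_ord; apply: leq_trans n300.
  have := spreading_card_lb lF sF n5; rewrite card_ord.
  rewrite -(ler_nat R) natrD !natrM => lb.
  have : 300 <= n%:R :> R by rewrite ler_nat.
  move: lb; move: (n%:R : R) (#|F|%:R : R) => x f; nra.
(* No error term is left: 5 q^2 + q is below 5/36 (6 q + 1)^2 = 5 q^2 + 5 q / 3 + 5/36. *)
exists (fun=> 0); first exact: cvg_cst.
move=> /finite_seqP[s sE].
(* A prime [q] above all listed elements yields the element 6 q + 1, which is larger still. *)
have [q sq qp] := prime_above (maxn 2 (\max_(i <- s) i)).
move: sq; rewrite gtn_max => /andP[q2 sq].
have [F [lF sF cF]] := spreading_exists qp q2.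
have : [set` s] (6 * q).+1.
  rewrite -sE /=; apply: le_lt_trans (xi_sp_le R lF sF) _.
  rewrite lte_fin addr0 -(natr1 (6 * q)%N) natrM.
  move: cF; rewrite -(ler_nat R) natrD !natrM.
  have : 2 < q%:R :> R by rewrite ltr_nat.
  move: (q%:R : R) (#|F|%:R : R) => x f; nra.
move=> /= /(@leq_bigmax_seq _ _ xpredT id)/(_ erefl); move: sq.
by move: (\max_(i <- s) i) => m; rewrite /=; lia.
Qed.
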